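(* Let $P$ be the inverse limit of a Fraïssé sequence in the category $\mathfrak I$ (defined in the context). A chainable continuum $K$ is homeomorphic to $P$ if and only if it satisfies the following condition: (P) Given $\varepsilon>0$ and given quotient maps $q\colon K\to\mathbb I$, $f\colon\mathbb I\to\mathbb I$, there exists a quotient map $g\colon K\to\mathbb I$ such that $\rho(f\circ g,q)<\varepsilon$.
   Context: $\mathbb I=[0,1]$. A quotient map between compact metrizable spaces is a continuous surjection. $\rho(f,g)=\max_t d(f(t),g(t))$ is the maximum distance, where $d$ is the metric of the codomain (for maps into $\mathbb I$ in condition (P): the usual metric). A continuum is a compact connected metrizable space; it is chainable if it is homeomorphic to the limit of an inverse sequence of quotient maps of $\mathbb I$ onto itself. The category $\mathfrak I$: objects are the metric spaces $\langle\mathbb I,d\rangle$ with $d(s,t)=m|s-t|$ for some integer $m>0$; an $\mathfrak I$-arrow from $X$ to $Y$ is a non-expansive (1-Lipschitz) piece-wise linear quotient map from $Y$ onto $X$ (so arrows are formally reversed). A Fraïssé sequence in $\mathfrak I$ is, written in terms of maps, an inverse sequence of $\mathfrak I$-objects $u_n$ ($n\in\omega$) with 1-Lipschitz piece-wise linear quotient maps $u_n^m\colon u_m\to u_n$ ($n\leqslant m$) such that: (U) for every $\mathfrak I$-object $x$ there are $n$ and a 1-Lipschitz piece-wise linear quotient map $u_n\to x$; (A) given $\varepsilon>0$, $n\in\omega$ and a 1-Lipschitz piece-wise linear quotient map $f\colon y\to u_n$ with $y$ an $\mathfrak I$-object, there exist $m>n$ and a 1-Lipschitz piece-wise linear quotient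 map $g\colon u_m\to y$ such that $\rho(f\circ g,u_n^m)<\varepsilon$. Such a sequence exists, and its inverse limit $P$ (in the category of compact spaces) is unique up to homeomorphism. *)

(* Defs.v *)
From mathcomp Require Import all_boot all_order all_algebra.
From mathcomp Require Import all_classical all_reals all_analysis.

Set Implicit Arguments.
Unset Strict Implicit.
Unset Printing Implicit Defensive.

Import Order.TTheory GRing.Theory Num.Theory.
Import numFieldNormedType.Exports.

Local Open Scope classical_set_scope.
Local Open Scope ring_scope.

Definition homeomorphic (X Y : topologicalType) : Prop :=
  exists (f : X -> Y) (g : Y -> X),
    [/\ continuous f, continuous g, cancel f g & cancel g f].

Definition metrizable (R : realType) (X : topologicalType) : Prop :=
  exists M : metricType R, homeomorphic X M.

Definition continuum (R : realType) (X : topologicalType) : Prop :=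
  [/\ compact [set: X], connected [set: X] & metrizable R X].

Definition quotient_map (X Y : topologicalType) (f : X -> Y) : Prop :=
  continuous f /\ set_surj [set: X] [set: Y] f.

(* [p n m : X m -> X n] is the bonding map from stage [m] to stage [n]; its
   values for [m < n] are junk and are never used. *)
Definition inverse_sequence (X : nat -> topologicalType)
    (p : forall n m, X m -> X n) : Prop :=
  (forall n, p n n =1 id) /\
  (forall n m k, (n <= m <= k)%N -> p n m \o p m k =1 p n k).

(* Coerced to a type, this set carries the topology of a subspace of the
   product of the [X n]. *)
Definition inverse_limit (X : nat -> topologicalType)
    (p : forall n m, X m -> X n) : set (prod_topology X) :=
  [set x | forall n m, (n <= m)%N -> p n m (x m) = x n].

Definition unitI (R : realType) : topologicalType :=
  set_type (`[0, 1]%classic : set R).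

Definition chainable (R : realType) (K : topologicalType) : Prop :=
  continuum R K /\
  exists p : nat -> nat -> unitI R -> unitI R,
    [/\ @inverse_sequence (fun=> unitI R) p,
        forall n m, (n <= m)%N -> quotient_map (p n m)
      & homeomorphic K (@inverse_limit (fun=> unitI R) p)].

(* The maximum distance of two maps. It is only applied to continuous maps,
   with a bounded metric [d] on the codomain and a compact domain, where this
   supremum is attained. *)
Definition rho (R : realType) (T Y : Type) (d : Y -> Y -> R) (f g : T -> Y) : R :=
  sup (range (fun t => d (f t) (g t))).

Definition dist01 (R : realType) (s t : unitI R) : R :=
  `|set_val s - set_val t|.

(* The object of the category with [scale] equal to [m] is the unit interval
   with metric [m * |s - t|]. All these metrics induce the usual topology, so
   that continuity is always expressed on [unitI R]. *)
Record Iobj := { scale : nat; scale_gt0 : (0 < scale)%N }.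

Definition Idist (R : realType) (x : Iobj) (s t : unitI R) : R :=
  (scale x)%:R * `|set_val s - set_val t|.

Definition nonexpansive (R : realType) (y x : Iobj) (f : unitI R -> unitI R) : Prop :=
  forall s t, Idist x (f s) (f t) <= Idist y s t.

(* [0 :: s] lists the break points in increasing order. *)
Definition piecewise_linear (R : realType) (f : unitI R -> unitI R) : Prop :=
  exists s : seq R, itv_partition 0 1 s /\
    forall i, (i < size s)%N -> exists a b : R, forall t : unitI R,
      nth 0 (0 :: s) i <= set_val t <= nth 0 s i ->
      set_val (f t) = a * set_val t + b.

(* [Imap y x f]: [f] is a map from [y] onto [x], i.e. an arrow of the category
   from [x] to [y]. *)
Definition Imap (R : realType) (y x : Iobj) (f : unitI R -> unitI R) : Prop :=
  [/\ quotient_map f, nonexpansive y x f & piecewise_linear f].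

Definition Fraisse_sequence (R : realType) (u : nat -> Iobj)
    (p : nat -> nat -> unitI R -> unitI R) : Prop :=
  [/\ @inverse_sequence (fun=> unitI R) p,
      forall n m, (n <= m)%N -> Imap (u m) (u n) (p n m),
      forall x : Iobj, exists n (f : unitI R -> unitI R), Imap (u n) x f
    & forall (eps : R) (n : nat) (y : Iobj) (f : unitI R -> unitI R),
        0 < eps -> Imap y (u n) f ->
        exists m (g : unitI R -> unitI R),
          [/\ (n < m)%N, Imap (u m) y g
            & rho (@Idist R (u n)) (f \o g) (p n m) < eps]].

Definition condition_P (R : realType) (K : topologicalType) : Prop :=
  forall (eps : R) (q : K -> unitI R) (f : unitI R -> unitI R),
    0 < eps -> quotient_map q -> quotient_map f ->
    exists g : K -> unitI R,
      quotient_map g /\ rho (@dist01 R) (f \o g) q < eps.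

(* Main.v *)
Require Import Defs.
From mathcomp Require Import all_boot all_order all_algebra.
From mathcomp Require Import all_classical all_reals all_analysis.
From mathcomp Require Import ring lra.

(** Write I for the unit interval. Both implications rest on one property of
    the Fraisse sequence that mentions neither scales nor piecewise linearity:
    the bonding maps absorb every quotient map f : I -> I, in the sense that
    each stage n has a later stage m and a quotient map g with f o g uniformly
    close to p n m ([absorbing]). It holds because a uniformly fine polygonal
    interpolation of f is a Lipschitz quotient map ([pl_factor]), and any
    Lipschitz map becomes non-expansive once the metric of its domain is scaled
    up enough, so condition (A) applies to it ([Fraisse_absorbing]).

    The limit satisfies (P). Let q : P -> I and f : I -> I be quotient maps. By
    compactness q is close to s o pi_n, for a projection pi_n and a quotient map
    s ([presentation_factor]). Mountain climbing is needed here: quotient maps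
    a, b of I with s o a close to f o b. The classical theorem can be avoided,
    since applying absorption at stage 0 to s and to f, and then moving to a
    common later stage, makes both composites close to the same bonding map
    ([absorbing_amalgam]). Absorb a at stage n, so that a o h is close to
    p n m; then f o (b o h o pi_m) is close to s o a o h o pi_m, hence to
    s o pi_n, hence to q ([absorbing_condition_P]).

    Uniqueness. Any two inverse limits K and L of intervals satisfying (P) are
    homeomorphic, by an approximate back-and-forth. One builds quotient maps
    f_k : K -> I and g_k : L -> I, and r_k : I -> I, such that r_k o f_(k+1) is
    close to f_k and r_k o g_(k+1) is close to g_k. To move forward from K,
    factor f_k approximately as r_k o pi_n with n large, take
    f_(k+1) = pi_n, and obtain g_(k+1) from (P) for L; then exchange the roles
    of K and L ([refine_step]). If the tolerances s_k shrink fast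
    enough, the relation `f_k x and g_k y are s_k-close for all k' is the graph
    of a homeomorphism ([matched_homeomorphic]): compactness provides partners,
    the fineness of the projections makes them unique, and the relation is
    closed. *)

Set Implicit Arguments.
Unset Strict Implicit.
Unset Printing Implicit Defensive.

Import Order.TTheory GRing.Theory Num.Theory.
Import numFieldNormedType.Exports.

Local Open Scope classical_set_scope.
Local Open Scope ring_scope.

(** * The unit interval *)

Section Metric.
Variable R : realType.
Local Notation I := (unitI R).
Implicit Types s t w : I.

Lemma unitI_ge0 t : 0 <= set_val t.
Proof. by have := set_valP t; rewrite /= in_itv /= => /andP[]. Qed.

Lemma unitI_le1 t : set_val t <= 1.
Proof. by have := set_valP t; rewrite /= in_itv /= => /andP[]. Qed.

Lemma dist01_ge0 s t : 0 <= dist01 s t.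
Proof. exact: normr_ge0. Qed.

Lemma dist01C s t : dist01 s t = dist01 t s.
Proof. exact: distrC. Qed.

Lemma dist01_le1 s t : dist01 s t <= 1.
Proof.
have := unitI_ge0 s; have := unitI_ge0 t.
have := unitI_le1 s; have := unitI_le1 t.
by rewrite /dist01 ler_norml => *; apply/andP; split; lra.
Qed.

Lemma dist01xx t : dist01 t t = 0.
Proof. by rewrite /dist01 subrr normr0. Qed.

Lemma dist01_triangle w s t : dist01 s t <= dist01 s w + dist01 w t.
Proof. exact: ler_distD. Qed.

Lemma dist01_eq0 s t : dist01 s t <= 0 -> s = t.
Proof.
by rewrite /dist01 normr_le0 subr_eq0 => /eqP; exact: val_inj.
Qed.

Lemma clamp01_subproof (x : R) :
  Num.min 1 (Num.max 0 x) \in (`[0, 1]%classic : set R).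
Proof.
rewrite inE /= in_itv /= le_min ler01 le_max lexx /=.
by rewrite ge_min lexx.
Qed.

Definition clamp01 (x : R) : I :=
  exist (fun y : R => y \in (`[0, 1]%classic : set R)) _ (clamp01_subproof x).

Lemma clamp01K (x : R) : 0 <= x <= 1 -> set_val (clamp01 x) = x.
Proof.
by move=> /andP[x0 x1]; rewrite set_valE /= max_r // min_r.
Qed.

Lemma clamp01_le (x : R) : x <= 0 -> set_val (clamp01 x) = 0.
Proof.
by move=> x0; rewrite set_valE /= max_l // min_r // ler01.
Qed.

Lemma clamp01_ge (x : R) : 1 <= x -> set_val (clamp01 x) = 1.
Proof.
by move=> x1; rewrite set_valE /= max_r ?min_l //; lra.
Qed.

Lemma clamp01_lip (x y : R) : dist01 (clamp01 x) (clamp01 y) <= `|x - y|.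
Proof.
wlog xy : x y / x <= y.
  move=> W; case: (leP x y) => [/W//|/ltW/W]; by rewrite dist01C distrC.
rewrite /dist01 !set_valE /= distrC (distrC x) (@ger0_norm _ (y - x)) ?subr_ge0 //.
rewrite ler_norml; case: (leP 0 x) => x0; case: (leP 0 y) => y0;
  rewrite ?(min_r (@ler01 R)); case: (leP 1 x) => x1; case: (leP 1 y) => y1;
  apply/andP; split; lra.
Qed.

Lemma val_continuous : continuous (set_val : I -> R).
Proof. exact: (@initial_continuous I R set_val). Qed.

Lemma dist01_continuous (T : topologicalType) (f g : T -> I) :
  continuous f -> continuous g -> continuous (fun x => dist01 (f x) (g x)).
Proof.
move=> cf cg x.
have cv (h : T -> I) : continuous h -> set_val (h y) @[y --> x] --> set_val (h x).
  move=> ch.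
  have := @continuous_comp _ _ _ h (set_val : I -> R) x (ch x) (@val_continuous (h x)).
  exact.
have := cvg_norm (cvgB (cv _ cf) (cv _ cg)). exact.
Qed.

Lemma closed_dist01_le (T : topologicalType) (f g : T -> I) (c : R) :
  continuous f -> continuous g -> closed [set x | dist01 (f x) (g x) <= c].
Proof.
move=> cf cg.
apply: (@preimage_closed _ R (fun x => dist01 (f x) (g x)) [set x | x <= c]).
  by move=> x _; exact: dist01_continuous.
exact: closed_le.
Qed.

Lemma closed_dist01_ge (T : topologicalType) (f g : T -> I) (c : R) :
  continuous f -> continuous g -> closed [set x | c <= dist01 (f x) (g x)].
Proof.
move=> cf cg.
apply: (@preimage_closed _ R (fun x => dist01 (f x) (g x)) [set x | c <= x]).
  by move=> x _; exact: dist01_continuous.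
exact: closed_ge.
Qed.

End Metric.

(** * Compactness *)

Section Compact.

(** Choosing a point in each set gives a sequence, any cluster point of which
    lies in all of them, because they are closed and decreasing. *)
Lemma compact_nested (T : topologicalType) (B : nat -> set T) :
  compact [set: T] -> (forall n, closed (B n)) ->
  (forall n m, (n <= m)%N -> B m `<=` B n) -> (forall n, B n !=set0) ->
  exists x, forall n, B n x.
Proof.
move=> cT cB dB /choice[z zB].
have [x [_ clx]] := cT (z @ \oo) _ filterT.
exists x => n; apply: (cB n) => A /clx; apply.
by exists n => // m /= /dB; apply; exact: zB.
Qed.

Lemma compact_set_type (T : topologicalType) (A : set T) :
  compact A -> compact [set: set_type A].
Proof.
move=> cA F PF _.
have FA : (set_val @ F) A.
  by apply: (@filterS _ F _ setT) => [x _|]; [exact: set_valP|exact: filterT].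
have [x [Ax clx]] := cA _ (fmap_proper_filter _ PF) FA.
exists (exist (fun y => y \in A) x (mem_set Ax)); split=> // U V FU [_ [[W oW <-]] /= Wx WV].
have [||y [Uy Wy]] := clx (set_val @` U) W.
- by apply: (@filterS _ F _ U) => // z Uz; exists z.
- by apply: open_nbhs_nbhs; split.
by case: Uy Wy => z Uz <- Wz; exists z; split=> //; exact: WV.
Qed.

End Compact.

(** * Piecewise linear approximation *)

Section Polygon.
Variable R : realType.
Local Notation I := (unitI R).

(** On [0, M] this is the polygonal interpolation of v at the integers 0..M.
    Writing it as a sum of clamped ramps, each constant outside one cell, makes
    it total and its Lipschitz bound immediate. *)
Definition polygon (v : nat -> R) (M : nat) (x : R) : R :=
  v 0%N + \sum_(j < M) (v j.+1 - v j) * set_val (clamp01 (x - j%:R)).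

Lemma polygon_past v M x : M%:R <= x -> polygon v M x = v M.
Proof.
rewrite /polygon; elim: M => [|M IH] Mx; first by rewrite big_ord0 addr0.
rewrite big_ord_recr /= addrA IH; last by move: Mx; rewrite -natr1; lra.
by rewrite clamp01_ge ?mulr1; [ring|move: Mx; rewrite -natr1; lra].
Qed.

Lemma polygon_cell v M k x : (k < M)%N -> k%:R <= x <= k.+1%:R ->
  polygon v M x = v k + (v k.+1 - v k) * (x - k%:R).
Proof.
move=> + /andP[kx xk]; elim: M => // M IH.
rewrite ltnS leq_eqVlt => /predU1P[kM|kM].
  subst M; rewrite /polygon big_ord_recr /= addrA.
  have := @polygon_past v k x; rewrite /polygon => /(_ kx) ->.
  by rewrite clamp01K //; apply/andP; move: xk; rewrite -natr1; split; lra.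
rewrite /polygon big_ord_recr /= addrA.
have := IH kM; rewrite /polygon => ->.
rewrite clamp01_le ?mulr0 ?addr0 //.
by rewrite subr_le0 (le_trans xk) // ler_nat.
Qed.

Lemma polygon_lip v M x y : (forall j, 0 <= v j <= 1) ->
  `|polygon v M x - polygon v M y| <= M%:R * `|x - y|.
Proof.
move=> v01; rewrite /polygon opprD addrACA subrr add0r -sumrB.
apply: (le_trans (ler_norm_sum _ _ _)).
have -> : M%:R * `|x - y| = \sum_(j < M) `|x - y|.
  by rewrite sumr_const card_ord mulr_natl.
apply: ler_sum => j _; rewrite -mulrBr normrM.
have := clamp01_lip (x - j%:R) (y - j%:R).
rewrite (_ : x - j%:R - _ = x - y); last by ring.
apply: le_trans; rewrite ler_piMl // ler_norml.
by have /andP[? ?] := v01 j; have /andP[? ?] := v01 j.+1; apply/andP; split; lra.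
Qed.

Lemma cell_exists M (x : R) : (0 < M)%N -> 0 <= x <= M%:R ->
  exists2 k, (k < M)%N & k%:R <= x <= k.+1%:R.
Proof.
elim: M => // M IH _ /andP[x0 xM].
case: (leP M%:R x) => Mx; first by exists M => //; rewrite Mx xM.
have [||k kM kx] := IH _ _.
- by rewrite lt0n; apply: contraTneq Mx => ->; rewrite -leNgt.
- by rewrite x0 ltW.
- by exists k => //; exact: ltnW.
Qed.

Lemma polygon_range v M x : (0 < M)%N -> (forall j, 0 <= v j <= 1) ->
  0 <= x <= M%:R -> 0 <= polygon v M x <= 1.
Proof.
move=> M0 v01 /(cell_exists M0)[k kM kx]; rewrite (polygon_cell _ kM kx).
have /andP[? ?] := v01 k; have /andP[? ?] := v01 k.+1.
by move: kx; rewrite -natr1 => /andP[? ?]; apply/andP; split; nra.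
Qed.

(** Polygons are used on [0, M], and s lives on [0, 1]; hence the rescaling by
    M. Surjectivity is the intermediate value theorem between a vertex of
    height 0 and one of height 1. *)
Lemma polygon_quotient (v : nat -> R) (M : nat) : (0 < M)%N ->
    (forall j, 0 <= v j <= 1) ->
    (exists2 i, (i <= M)%N & v i = 0) -> (exists2 i, (i <= M)%N & v i = 1) ->
  exists s : I -> I,
    [/\ quotient_map s, piecewise_linear s,
        forall a b, dist01 (s a) (s b) <= (M * M)%:R * dist01 a b
      & forall t, set_val (s t) = polygon v M (M%:R * set_val t)].
Proof.
move=> M0 v01 [i0 i0M vi0] [i1 i1M vi1].
have MR0 : 0 < M%:R :> R by rewrite ltr0n.
pose F (x : R) := polygon v M (M%:R * x).
have Flip x y : `|F x - F y| <= (M * M)%:R * `|x - y|.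
  apply: (le_trans (polygon_lip _ _ _ v01)).
  by rewrite -mulrBr normrM (ger0_norm (ltW MR0)) mulrA natrM.
have MM0 : 0 < (M * M)%:R :> R by rewrite ltr0n muln_gt0 M0.
have Fcont : continuous F.
  move=> x; apply/cvgrPdist_le => /= e e0.
  near=> y; apply: (le_trans (Flip _ _)); rewrite -ler_pdivlMl //.
  near: y; apply: (@cvgr_dist_le _ _ _ (nbhs x)); first exact: cvg_id.
  by rewrite mulr_gt0 // invr_gt0.
have Fval i : (i <= M)%N -> F (i%:R / M%:R) = v i.
  move=> iM; rewrite /F mulrCA divff ?gt_eqF // mulr1.
  move: iM; rewrite leq_eqVlt => /predU1P[->|iM]; first exact: polygon_past.
  by rewrite (polygon_cell v iM) ?subrr ?mulr0 ?addr0 // lexx ler_nat leqnSn.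
pose s (t : I) := clamp01 (F (set_val t)).
have sE t : set_val (s t) = F (set_val t).
  rewrite clamp01K // polygon_range // mulr_ge0 ?ler0n ?unitI_ge0 //=.
  by rewrite ler_piMr ?ler0n ?unitI_le1.
have div01 i : (i <= M)%N -> 0 <= (i%:R / M%:R : R) <= 1.
  by move=> iM; rewrite divr_ge0 ?ler0n //= ler_pdivrMr // mul1r ler_nat.
exists s; split.
- split.
    apply: (@continuous_comp_initial I I R set_val s).
    rewrite (_ : _ \o _ = F \o set_val); last by apply/funext => t; exact: sE.
    by move=> t; apply: continuous_comp; [exact: val_continuous|exact: Fcont].
  move=> w _; set a := i0%:R / M%:R : R; set b := i1%:R / M%:R : R.
  have /andP[a0 a1] : 0 <= a <= 1 := div01 _ i0M.
  have /andP[b0 b1] : 0 <= b <= 1 := div01 _ i1M.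
  have Fa : F a = 0 by rewrite Fval.
  have Fb : F b = 1 by rewrite Fval.
  have w0 := unitI_ge0 w; have w1 := unitI_le1 w.
  have [c /andP[c0 c1] Fc] : exists2 c, 0 <= c <= 1 & F c = set_val w.
    case: (leP a b) => [ab|/ltW ab].
      have [||c] := @IVT _ F a b (set_val w) ab.
      - by apply: continuous_subspaceT.
      - by rewrite Fa Fb min_l ?max_r ?ler01 // w0 w1.
      by rewrite in_itv /= => /andP[ac cb] Fc; exists c => //; apply/andP; split; lra.
    have [||c] := @IVT _ F b a (set_val w) ab.
    - by apply: continuous_subspaceT.
    - by rewrite Fa Fb min_r ?max_l ?ler01 // w0 w1.
    by rewrite in_itv /= => /andP[ac cb] Fc; exists c => //; apply/andP; split; lra.
  have tK : set_val (clamp01 c) = c by rewrite clamp01K // c0 c1.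
  by exists (clamp01 c) => //; apply: val_inj; have := sE (clamp01 c); rewrite tK Fc.
- pose l := [seq j.+1%:R / M%:R : R | j <- iota 0 M].
  have sl : size l = M by rewrite size_map size_iota.
  have ln i : (i < M)%N -> nth 0 l i = i.+1%:R / M%:R.
    by move=> iM; rewrite (nth_map 0%N) ?size_iota // nth_iota.
  have l0n i : (i <= M)%N -> nth 0 (0 :: l) i = i%:R / M%:R.
    by case: i => [|i] iM /=; [rewrite mul0r|rewrite ln].
  exists l; split.
    split.
      apply/(pathP 0) => i; rewrite sl => iM.
      by rewrite l0n ?(ltnW iM) // ln // ltr_pM2r ?invr_gt0 // ltr_nat.
    by rewrite (last_nth 0) sl l0n // divff // gt_eqF.
  move=> i; rewrite sl => iM.
  exists ((v i.+1 - v i) * M%:R), (v i - (v i.+1 - v i) * i%:R) => t.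
  rewrite l0n ?(ltnW iM) // ln // ler_pdivrMr // ler_pdivlMr // mulrC => it.
  by rewrite sE /F (polygon_cell v iM it); ring.
- by move=> a b; rewrite /dist01 !sE; exact: Flip.
- exact: sE.
Unshelve. all: by end_near.
Qed.

(** If h is, up to e, a uniformly continuous function of q, then it almost
    factors through q: interpolate the values of h at points lying over a grid
    of mesh at most d. These values come within e of 0 and of 1 without
    necessarily reaching them, so they are first pushed outwards by
    y |-> (y - e) / (1 - 2 e), clamped, which moves them by at most 2 e and lets
    the polygon be surjective. Taking q = id approximates a quotient map of I;
    taking q a projection of an inverse limit gives the factorization through
    that projection. *)
Lemma pl_factor (T : Type) (q h : T -> I) (d e : R) :
    0 < d -> 0 < e <= 4^-1 ->
    (forall t, exists x, q x = t) -> (forall t, exists x, h x = t) ->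
    (forall x y, dist01 (q x) (q y) <= d -> dist01 (h x) (h y) <= e) ->
  exists s : I -> I,
    [/\ quotient_map s, piecewise_linear s,
        exists2 C : nat, (0 < C)%N &
          forall a b, dist01 (s a) (s b) <= C%:R * dist01 a b
      & forall x, dist01 (s (q x)) (h x) <= 3 * e].
Proof.
move=> d0 /andP[e0 e4] qs hs qh.
have [M M0 Md] : exists2 M, (0 < M)%N & M%:R^-1 <= d.
  exists (Num.bound d^-1).+1 => //.
  have := archi_boundP (ltW (_ : 0 < d^-1)); rewrite invr_gt0 => /(_ d0) dM.
  rewrite invf_ple ?posrE // (le_trans (ltW dM)) // ler_nat //.
have MR0 : 0 < M%:R :> R by rewrite ltr0n.
have /choice[x xE] := fun j : nat => qs (clamp01 (j%:R / M%:R)).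
have qx j : (j <= M)%N -> set_val (q (x j)) = j%:R / M%:R.
  move=> jM; rewrite xE clamp01K // divr_ge0 ?ler0n //=.
  by rewrite ler_pdivrMr // mul1r ler_nat.
have qclose y k j : (k < M)%N -> k%:R <= M%:R * set_val (q y) <= k.+1%:R ->
    (k <= j <= k.+1)%N -> dist01 (h (x j)) (h y) <= e.
  move=> kM /andP[ky yk] /andP[kj jk]; apply: qh; apply: le_trans Md.
  rewrite /dist01 qx; last exact: leq_trans jk kM.
  rewrite -(ler_pM2l MR0) -{1}(ger0_norm (ltW MR0)) -normrM mulrBr.
  rewrite mulrCA divff ?gt_eqF // mulr1.
  have : k%:R <= j%:R :> R by rewrite ler_nat.
  have : j%:R <= k.+1%:R :> R by rewrite ler_nat.
  move: yk; rewrite -natr1 ler_norml => *; apply/andP; split; lra.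
have cellq y : exists2 k, (k < M)%N & k%:R <= M%:R * set_val (q y) <= k.+1%:R.
  apply: cell_exists => //; rewrite mulr_ge0 ?ler0n ?unitI_ge0 //=.
  by rewrite ler_piMr ?ler0n ?unitI_le1.
pose v j := set_val (clamp01 ((set_val (h (x j)) - e) / (1 - 2 * e))).
have e2 : 0 < 1 - 2 * e by lra.
have v01 j : 0 <= v j <= 1 by rewrite unitI_ge0 unitI_le1.
have vh j : `|v j - set_val (h (x j))| <= 2 * e.
  rewrite /v; set y := set_val (h (x j)).
  have y0 : 0 <= y := unitI_ge0 _; have y1 : y <= 1 := unitI_le1 _.
  case: (leP y e) => ye.
    rewrite clamp01_le; last by rewrite pmulr_lle0 ?invr_gt0 // subr_le0.
    by rewrite ler_norml; apply/andP; split; lra.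
  case: (leP (1 - e) y) => ye'.
    rewrite clamp01_ge; last by rewrite ler_pdivlMr // mul1r; lra.
    by rewrite ler_norml; apply/andP; split; lra.
  rewrite clamp01K; last first.
    by rewrite divr_ge0 ?ler_pdivrMr ?mul1r //=; lra.
  have -> : (y - e) / (1 - 2 * e) - y = (e * (2 * y - 1)) / (1 - 2 * e).
    by field; lra.
  rewrite ler_norml ler_pdivlMr // ler_pdivrMr //; apply/andP; split; nra.
have near0 : exists2 i, (i <= M)%N & v i = 0.
  have [y hy] := hs (clamp01 0); have [k kM ky] := cellq y.
  exists k; first exact: ltnW.
  rewrite /v clamp01_le // pmulr_lle0 ?invr_gt0 // subr_le0.
  have := @qclose y k k kM ky; rewrite leqnn leqnSn => /(_ erefl).
  by rewrite hy /dist01 clamp01_le // subr0 ger0_norm ?unitI_ge0.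
have near1 : exists2 i, (i <= M)%N & v i = 1.
  have [y hy] := hs (clamp01 1); have [k kM ky] := cellq y.
  exists k; first exact: ltnW.
  rewrite /v clamp01_ge // ler_pdivlMr // mul1r.
  have := @qclose y k k kM ky; rewrite leqnn leqnSn => /(_ erefl).
  rewrite hy /dist01 clamp01_ge // ler_norml => /andP[? ?]; lra.
have [s [sq spl slip sE]] := polygon_quotient M0 v01 near0 near1.
exists s; split=> //; first by exists (M * M)%N => //; rewrite muln_gt0 M0.
move=> y; have [k kM ky] := cellq y.
rewrite /dist01 sE (polygon_cell v kM ky).
have := @qclose y k k kM ky; rewrite leqnn leqnSn => /(_ erefl).
have := @qclose y k k.+1 kM ky; rewrite leqnn leqnSn => /(_ erefl).
have := vh k; have := vh k.+1; rewrite /dist01 !ler_norml.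
set t := M%:R * _ - _.
have : 0 <= t <= 1 by move: ky; rewrite -natr1 /t => /andP[? ?]; apply/andP; split; lra.
move=> /andP[? ?] /andP[? ?] /andP[? ?] /andP[? ?] /andP[? ?].
have -> : v k + (v k.+1 - v k) * t - set_val (h y)
  = (1 - t) * (v k - set_val (h y)) + t * (v k.+1 - set_val (h y)) by ring.
by apply/andP; split; nra.
Qed.

End Polygon.

(** * Uniform continuity *)

Section Moduli.
Variable R : realType.
Local Notation I := (unitI R).

Lemma unitI_compact : compact [set: I].
Proof. exact/compact_set_type/segment_compact. Qed.

Lemma quotient_surj (X Y : topologicalType) (f : X -> Y) :
  quotient_map f -> forall y, exists x, f x = y.
Proof. by move=> [_ fs] y; have [//|x _ <-] := fs y; exists x. Qed.

Lemma quotient_comp (X Y Z : topologicalType) (f : X -> Y) (g : Y -> Z) :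
  quotient_map f -> quotient_map g -> quotient_map (g \o f).
Proof.
move=> [cf sf] [cg sg]; split.
  by move=> x; apply: continuous_comp; [exact: cf|exact: cg].
move=> z /sg[y _ <-]; have [//|x _ <-] := sf y; by exists x.
Qed.

Lemma invS_gt0 n : 0 < n.+1%:R^-1 :> R.
Proof. by rewrite invr_gt0 ltr0n. Qed.

Lemma invS_le n m : (n <= m)%N -> m.+1%:R^-1 <= n.+1%:R^-1 :> R.
Proof. by move=> nm; rewrite lef_pV2 ?posrE ?ltr0n // ler_nat. Qed.

Lemma le_invS_eq0 (x : R) N :
  (forall n, (N <= n)%N -> x <= n.+1%:R^-1) -> x <= 0.
Proof.
move=> xn; rewrite leNgt; apply/negP => x0.
have := archi_boundP (ltW (_ : 0 < x^-1)); rewrite invr_gt0 => /(_ x0) xb.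
have := xn (maxn N (Num.bound x^-1)) (leq_maxl _ _).
apply/negP; rewrite -ltNge invf_plt ?posrE //.
apply: (lt_le_trans xb); rewrite ler_nat.
exact: leq_trans (leq_maxr N _) (leqnSn _).
Qed.

(** A continuous function on a compact space is uniformly continuous with
    respect to any countable separating family q: otherwise pairs on which
    q 0, ..., q N nearly agree but h does not would accumulate at a pair on
    which every q n agrees. *)
Lemma compact_modulus (K : topologicalType) (q : nat -> K -> I) (h : K -> I)
    (e : R) :
    compact [set: K] -> (forall n, continuous (q n)) ->
    (forall x y, (forall n, q n x = q n y) -> x = y) -> continuous h -> 0 < e ->
  exists N, forall x y,
    (forall i, (i <= N)%N -> dist01 (q i x) (q i y) <= N.+1%:R^-1) ->
    dist01 (h x) (h y) <= e.
Proof.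
move=> cK cq sep ch e0; apply: contrapT => noN.
pose B N := [set z : K * K | e <= dist01 (h z.1) (h z.2)] `&`
  \bigcap_(i in [set i | (i <= N)%N])
    [set z : K * K | dist01 (q i z.1) (q i z.2) <= N.+1%:R^-1].
have c1 (g : K -> I) : continuous g -> continuous (fun z : K * K => g z.1).
  by move=> cg z; apply: (continuous_comp _ (cg _)); exact: cvg_fst.
have c2 (g : K -> I) : continuous g -> continuous (fun z : K * K => g z.2).
  by move=> cg z; apply: (continuous_comp _ (cg _)); exact: cvg_snd.
have [||||z zB] := @compact_nested _ B.
- by rewrite -setXTT; exact: compact_setX.
- move=> N; apply: closedI.
    by apply: closed_dist01_ge; [exact: c1|exact: c2].
  by apply: closed_bigI => i _; apply: closed_dist01_le; [exact: c1|exact: c2].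
- move=> n m nm z [ez zi]; split=> // i /= ni.
  by apply: le_trans (zi i (leq_trans ni nm)) _; exact: invS_le.
- move=> N; apply: contrapT => B0; apply: noN; exists N => x y xy.
  rewrite leNgt; apply/negP => exy; apply: B0; exists (x, y).
  by split=> [/=|i /xy //]; exact: ltW.
have z12 : z.1 = z.2.
  apply: sep => n; apply: dist01_eq0; apply: (@le_invS_eq0 _ n) => m nm.
  by have [_] := zB m; exact.
by have [/=] := zB 0%N; rewrite z12 dist01xx leNgt e0.
Qed.

Lemma uniform_modulus (f : I -> I) (e : R) : continuous f -> 0 < e ->
  exists2 d, 0 < d & forall s t, dist01 s t <= d -> dist01 (f s) (f t) <= e.
Proof.
move=> cf e0.
have [||N fN] := compact_modulus (q := fun=> id) unitI_compact _ _ cf e0.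
- by move=> n x.
- by move=> x y /(_ 0%N).
by exists N.+1%:R^-1; [exact: invS_gt0|move=> s t st; exact: fN].
Qed.

Lemma finite_modulus (f : nat -> I -> I) N (e : R) :
    (forall i, (i <= N)%N -> continuous (f i)) -> 0 < e ->
  exists2 d, 0 < d &
    forall i s t, (i <= N)%N -> dist01 s t <= d -> dist01 (f i s) (f i t) <= e.
Proof.
move=> + e0; elim: N => [|N IH] cf.
  have [d d0 dP] := uniform_modulus (cf 0%N isT) e0.
  by exists d => // -[|//] s t _; exact: dP.
have [i iN|d d0 dP] := IH; first by apply: cf; exact: ltnW.
have [d' d'0 d'P] := uniform_modulus (cf N.+1 (leqnn _)) e0.
exists (Num.min d d'); first by rewrite lt_min d0.
move=> i s t; rewrite le_min leq_eqVlt => /predU1P[->|iN] /andP[sd sd'].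
  exact: d'P.
exact: dP.
Qed.

End Moduli.

(** * Inverse limits of intervals *)

Section Presentation.
Variable R : realType.
Local Notation I := (unitI R).
Implicit Types (p : nat -> nat -> I -> I) (K : topologicalType).

(** For compact K this says that (q n) exhibits K as a copy of the inverse limit
    of p, and it avoids handling threads and subspaces of a product. *)
Definition presentation p K (q : nat -> K -> I) : Prop :=
  [/\ compact [set: K], forall n m, (n <= m)%N -> quotient_map (p n m),
      forall n, quotient_map (q n),
      forall n m, (n <= m)%N -> p n m \o q m =1 q n
    & forall x y, (forall n, q n x = q n y) -> x = y].

Lemma compact_inverse_limit p :
  (forall n m, (n <= m)%N -> continuous (p n m)) ->
  compact [set: @inverse_limit (fun=> I) p].
Proof.
move=> cp; apply: compact_set_type.
apply: (@subclosed_compact _ _ [set x : prod_topology (fun=> I) | forall i, setT (x i)]) => //.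
  have cpr i : continuous (fun x : prod_topology (fun _ : nat => I) => x i).
    exact: (@proj_continuous nat (fun=> I) i).
  rewrite (_ : inverse_limit _ = \bigcap_(nm in [set nm : nat * nat | (nm.1 <= nm.2)%N])
     [set x | dist01 (p nm.1 nm.2 (x nm.2)) (x nm.1) <= 0]).
    apply: closed_bigI => -[n m] /= nm; apply: closed_dist01_le => // x.
    by apply: (@continuous_comp _ _ _ (fun x : prod_topology (fun _ : nat => I) => x m));
      [exact: cpr|exact: cp].
  apply/seteqP; split => [x xp [n m] /= nm|x xp n m nm].
    by rewrite xp // dist01xx.
  by apply: dist01_eq0; exact: (xp (n, m)).
by apply: (@tychonoff nat (fun=> I) (fun=> setT)) => _; exact: unitI_compact.
Qed.

(** Lift t through all later stages by sections of the one-step bonding maps.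
    The coordinate m of the thread is read off stage n + m, which is beyond both
    n and m, so that no case distinction between m < n and n <= m is needed. *)
Lemma inverse_limit_thread p n t : @inverse_sequence (fun=> I) p ->
    (forall n m, (n <= m)%N -> quotient_map (p n m)) ->
  exists2 x : prod_topology (fun=> I), @inverse_limit (fun=> I) p x & x n = t.
Proof.
move=> [p1 pc] pq.
have /choice[sec secP] : forall m : nat, exists s : I -> I, forall t, p m m.+1 (s t) = t.
  by move=> m; have /choice[s sP] := quotient_surj (pq m m.+1 (leqnSn m)); exists s.
pose y := fix y k := if k is k'.+1 then sec (n + k')%N (y k') else t.
have yP m k : (m <= k)%N -> p (n + m)%N (n + k)%N (y k) = y m.
  elim: k => [|k IH]; first by rewrite leqn0 => /eqP ->; rewrite p1.
  rewrite leq_eqVlt => /predU1P[->|]; first by rewrite p1.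
  rewrite ltnS => mk; rewrite -(pc _ (n + k)%N); last by rewrite leq_add2l mk leq_add2l /=.
  by rewrite /= addnS secP IH.
exists (fun m => p m (n + m)%N (y m)) => [m k mk|].
  rewrite -[p m k _]/((p m k \o p k (n + k)%N) (y k)) pc ?mk ?leq_addl //.
  rewrite -(pc _ (n + m)%N) /= ?yP // leq_addl /= leq_add2l //.
by have := @yP 0%N n (leq0n n); rewrite addn0.
Qed.

Lemma presentation_of_homeo p K : @inverse_sequence (fun=> I) p ->
    (forall n m, (n <= m)%N -> quotient_map (p n m)) -> compact [set: K] ->
    homeomorphic K (@inverse_limit (fun=> I) p) ->
  exists q : nat -> K -> I, presentation p q.
Proof.
move=> pi pq cK [f [g [cf cg fK gK]]].
have cv : continuous (set_val : @inverse_limit (fun=> I) p -> prod_topology (fun=> I)).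
  exact: initial_continuous.
exists (fun n x => (set_val (f x)) n); split=> //.
- move=> n; split.
    move=> x; apply: (@continuous_comp _ _ _ (set_val \o f) (fun z => z n)).
      by apply: continuous_comp; [exact: cf|exact: cv].
    exact: (@proj_continuous nat (fun=> I) n).
  move=> t _; have [x xp xn] := inverse_limit_thread n t pi pq.
  exists (g (exist (fun y => y \in @inverse_limit (fun=> I) p) x (mem_set xp))) => //.
  by rewrite gK.
- by move=> n m nm x; exact: (set_valP (f x)).
- move=> x y xy; apply: (can_inj fK); apply: val_inj.
  by apply: functional_extensionality_dep.
Qed.

(** The stage n can be as late as desired, so that q n also determines the
    coordinates up to N with precision 1 / (N + 1). *)
Lemma presentation_factor p K (q : nat -> K -> I) (h : K -> I) (e : R) N :
    presentation p q -> quotient_map h -> 0 < e ->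
  exists n s d, [/\ quotient_map s, forall x, dist01 (s (q n x)) (h x) <= e,
    0 < d & forall i x y, (i <= N)%N -> dist01 (q n x) (q n y) <= d ->
      dist01 (q i x) (q i y) <= N.+1%:R^-1].
Proof.
move=> [cK pq qq qp qsep] [ch hs] e0.
(* Interpolation needs a tolerance at most 1/4 and triples it. *)
pose e1 := Num.min 4^-1 (e / 3).
have e10 : 0 < e1 by rewrite lt_min invr_gt0 ltr0n divr_gt0.
have cq n : continuous (q n) by case: (qq n).
have [n0 n0P] := compact_modulus cK cq qsep ch e10.
pose n := maxn N n0.
have [d d0 dP] : exists2 d : R, 0 < d & forall i x y, (i <= n)%N ->
    dist01 (q n x) (q n y) <= d -> dist01 (q i x) (q i y) <= n.+1%:R^-1.
  have [i ni|d d0 dP] := @finite_modulus _ (fun i => p i n) n _ _ (invS_gt0 R n).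
    by case: (pq i n ni).
  by exists d => // i x y ni xy; rewrite -!(qp _ _ ni); exact: dP.
have [||||s [sq _ _ sh]] := @pl_factor R K (q n) h d e1 d0.
- by rewrite e10 ge_min lexx.
- exact: quotient_surj (qq n).
- exact: quotient_surj (conj ch hs).
- move=> x y xy; apply: n0P => i i0.
  apply: le_trans (dP i x y _ xy) (invS_le _ _); last exact: leq_maxr.
  exact: leq_trans i0 (leq_maxr _ _).
exists n, s, d; split=> // [x|i x y iN xy].
  apply: le_trans (sh x) _; have : e1 <= e / 3 by rewrite ge_min lexx orbT.
  lra.
apply: le_trans (dP i x y _ xy) (invS_le _ _); last exact: leq_maxl.
exact: leq_trans iN (leq_maxl _ _).
Qed.

End Presentation.

(** * Absorption *)

Section Absorption.
Variable R : realType.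
Local Notation I := (unitI R).
Implicit Types (p : nat -> nat -> I -> I) (K : topologicalType).

Lemma rho_lt (T Y : Type) (d : Y -> Y -> R) (f g : T -> Y) (b e : R) :
  (forall s t, d s t <= b) -> rho d f g < e -> forall t, d (f t) (g t) < e.
Proof.
move=> db de t; apply: le_lt_trans de; apply: ub_le_sup; last by exists t.
by exists b => _ [u _ <-].
Qed.

Lemma rho_le (T Y : Type) (d : Y -> Y -> R) (f g : T -> Y) (e : R) (t0 : T) :
  (forall t, d (f t) (g t) <= e) -> rho d f g <= e.
Proof.
move=> de; apply: ge_sup; first by exists (d (f t0) (g t0)), t0.
by move=> _ [t _ <-].
Qed.

Definition absorbing p : Prop :=
  forall n (f : I -> I) (e : R), 0 < e -> quotient_map f ->
  exists m (g : I -> I), [/\ (n < m)%N, quotient_map g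
    & forall t, dist01 (f (g t)) (p n m t) <= e].

(** The scale C * scale (u n), with C a Lipschitz constant of the interpolation,
    makes the latter non-expansive onto u n. *)
Lemma Fraisse_absorbing (u : nat -> Iobj) p :
  Fraisse_sequence u p -> absorbing p.
Proof.
move=> [_ _ _ amalg] n f e e0 fq.
(* Interpolation costs 3 * e / 8, which leaves e / 2 for the amalgamation. *)
pose e1 := Num.min 4^-1 (e / 8).
have e10 : 0 < e1 by rewrite lt_min invr_gt0 ltr0n divr_gt0.
have e18 : e1 <= e / 8 by rewrite ge_min lexx orbT.
have [cf _] := fq.
have [d d0 fd] := uniform_modulus cf e10.
have [||||s [sq spl [C C0 slip] sf]] := @pl_factor R I id f d e1 d0.
- by rewrite e10 ge_min lexx.
- by move=> t; exists t.
- exact: quotient_surj.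
- exact: fd.
have u0 : 0 < (scale (u n))%:R :> R by rewrite ltr0n scale_gt0.
have y0 : (0 < scale (u n) * C)%N by rewrite muln_gt0 scale_gt0.
have sI : Imap (Build_Iobj y0) (u n) s.
  split=> // a b; rewrite /Idist /= natrM -mulrA ler_pM2l //.
  exact: slip.
have e20 : 0 < e / 2 by rewrite divr_gt0.
have [m [g [nm [gq _ _] gs]]] := amalg _ n _ s e20 sI.
exists m, g; split=> // t.
have Ib a b : Idist (u n) a b <= (scale (u n))%:R :> R.
  by rewrite /Idist ler_piMr ?(ltW u0) //; exact: dist01_le1.
have Ige a b : dist01 a b <= Idist (u n) a b :> R.
  by apply: ler_peMl; [exact: dist01_ge0|rewrite ler1n scale_gt0].
have := rho_lt Ib gs t; have := Ige (s (g t)) (p n m t); have := sf (g t).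
have := dist01_triangle (s (g t)) (f (g t)) (p n m t).
rewrite (dist01C (f _) (s _)) /=; lra.
Qed.

(** Approximate mountain climbing: absorbing s and f at the same stage 0 makes
    each of them close to a bonding map into that stage after composition, and
    these bonding maps agree from a common later stage. *)
Lemma absorbing_amalgam p (s f : I -> I) (e : R) :
    @inverse_sequence (fun=> I) p ->
    (forall n m, (n <= m)%N -> quotient_map (p n m)) -> absorbing p ->
    quotient_map s -> quotient_map f -> 0 < e ->
  exists a b : I -> I, [/\ quotient_map a, quotient_map b
    & forall t, dist01 (s (a t)) (f (b t)) <= e].
Proof.
move=> [_ pc] pq pa sq fq e0.
have e20 : 0 < e / 2 by rewrite divr_gt0.
have [m [a [_ aq sa]]] := pa 0%N _ _ e20 sq.
have [k [b [_ bq fb]]] := pa 0%N _ _ e20 fq.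
exists (a \o p m (maxn m k)), (b \o p k (maxn m k)); split.
- by apply: quotient_comp aq; apply: pq; exact: leq_maxl.
- by apply: quotient_comp bq; apply: pq; exact: leq_maxr.
move=> t /=; set a' := a _; set b' := b _.
have := sa (p m (maxn m k) t); have := fb (p k (maxn m k) t).
have := pc 0%N m (maxn m k); rewrite leq_maxl => /(_ erefl t) /= ->.
have := pc 0%N k (maxn m k); rewrite leq_maxr => /(_ erefl t) /= ->.
have := dist01_triangle (p 0%N (maxn m k) t) (s a') (f b').
by rewrite (dist01C (p 0%N _ t) (f b')); lra.
Qed.

Lemma absorbing_condition_P p K (q : nat -> K -> I) :
  @inverse_sequence (fun=> I) p -> presentation p q -> absorbing p ->
  condition_P R K.
Proof.
move=> pi pK pa e h f e0 hq fq.
have [_ pq qq qp _] := pK.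
have e50 : 0 < e / 5 by rewrite divr_gt0.
have [n [s [_ [sq sh _ _]]]] := presentation_factor 0 pK hq e50.
have [a [b [aq bq ab]]] := absorbing_amalgam pi pq pa sq fq e50.
have [cs _] := sq.
have [d d0 sd] := uniform_modulus cs e50.
have [m [g [nm gq ag]]] := pa n a d d0 aq.
exists (b \o g \o q m); split.
  by apply: quotient_comp (qq m) _; exact: quotient_comp gq bq.
have [x0 _] := quotient_surj hq (clamp01 0).
(* Three errors: f b ~ s a, then s a g ~ s (p n m), then s (q n) ~ h. *)
apply: (@le_lt_trans _ _ (3 * (e / 5))); last by lra.
apply: rho_le => // x /=; set t := q m x.
have := sd _ _ (ag t); have /= -> := qp n m (ltnW nm) x => sag.
have := ab (g t); have := sh x.
have := dist01_triangle (s (a (g t))) (f (b (g t))) (h x).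
have := dist01_triangle (s (q n x)) (s (a (g t))) (h x).
rewrite (dist01C (f _) (s _)); lra.
Qed.

End Absorption.

(** * Homeomorphisms from matched sequences of maps *)

Section Matching.
Variable R : realType.
Local Notation I := (unitI R).

Lemma separated_hausdorff (K : topologicalType) (q : nat -> K -> I) :
  (forall n, continuous (q n)) ->
  (forall x y, (forall n, q n x = q n y) -> x = y) -> hausdorff_space K.
Proof.
move=> cq sep x y clxy; apply: sep => n; apply: dist01_eq0.
rewrite leNgt; apply/negP => xy.
pose e := dist01 (q n x) (q n y) / 2.
have e0 : 0 < e by rewrite divr_gt0.
have nb z : nbhs z [set w | dist01 (q n z) (q n w) < e].
  apply: open_nbhs_nbhs; split; last by rewrite /= dist01xx.
  rewrite (_ : [set _ | _] = ~` [set w | e <= dist01 (q n z) (q n w)]).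
    apply: closed_openC; apply: closed_dist01_ge; last exact: cq.
    by move=> ?; exact: cst_continuous.
  by apply/seteqP; split=> w /=; rewrite ltNge => /negP.
have [z /= [xz yz]] := clxy _ _ (nb x) (nb y).
have := dist01_triangle (q n z) (q n x) (q n y).
rewrite (dist01C (q n z)) leNgt => /negP; apply.
by move: xz yz; rewrite /e; lra.
Qed.

(** The thirds leave room, in [matched_map], for the deviation of each of two
    coherent families and for the oscillation of r k. *)
Definition coherent (X : Type) (r : nat -> I -> I) (s : nat -> R) (f : nat -> X -> I) :=
  forall k x, dist01 (r k (f k.+1 x)) (f k x) <= s k / 3.

(** Call x and y partners up to n if f k x and g k y are s k-close for k <= n.
    Any y with g n y = f n x is such a partner of x, because r k maps
    s (k+1)-close points to (s k / 3)-close ones and each of the two sequences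
    is off by at most s k / 3. Compactness of L then yields a partner of x valid
    at all stages. It is unique, two partners being 2 s k-close, and depends
    continuously on x, since being partners is a closed relation. *)
Lemma matched_map (K L : topologicalType) (f : nat -> K -> I) (g : nat -> L -> I)
    (r : nat -> I -> I) (s : nat -> R) :
    compact [set: L] ->
    (forall k, quotient_map (f k)) -> (forall k, quotient_map (g k)) ->
    (forall k, 0 < s k) ->
    coherent r s f -> coherent r s g ->
    (forall k a b, dist01 a b <= s k.+1 -> dist01 (r k a) (r k b) <= s k / 3) ->
    (forall y y', (forall k, dist01 (g k y) (g k y') <= 2 * s k) -> y = y') ->
  exists phi : K -> L,
    continuous phi /\ forall x k, dist01 (f k x) (g k (phi x)) <= s k.
Proof.
move=> cL fq gq s0 rf rg rs sepg.
have cf k : continuous (f k) by case: (fq k).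
have cg k : continuous (g k) by case: (gq k).
have descend x y k : dist01 (f k.+1 x) (g k.+1 y) <= s k.+1 ->
    dist01 (f k x) (g k y) <= s k.
  move=> /rs; have := rf k x; have := rg k y.
  have := dist01_triangle (r k (f k.+1 x)) (f k x) (g k y).
  have := dist01_triangle (r k (g k.+1 y)) (r k (f k.+1 x)) (g k y).
  rewrite (dist01C (f k x) (r k _)); lra.
have descend_to x y j k : dist01 (f (j + k)%N x) (g (j + k)%N y) <= s (j + k)%N ->
    dist01 (f k x) (g k y) <= s k.
  by elim: j => // j IH /descend.
have /choice[phi phiP] : forall x, exists y, forall k, dist01 (f k x) (g k y) <= s k.
  move=> x.
  pose B n := \bigcap_(k in [set k | (k <= n)%N]) [set y | dist01 (f k x) (g k y) <= s k].
  have [|||y yB] := @compact_nested _ B cL.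
  - move=> n; apply: closed_bigI => k _; apply: closed_dist01_le => //.
    by move=> ?; exact: cst_continuous.
  - by move=> n m nm y yB k kn; apply: yB; exact: leq_trans kn nm.
  - move=> n; have [y yx] := quotient_surj (gq n) (f n x).
    exists y => k /= kn; apply: (descend_to x y (n - k)%N).
    by rewrite subnK // yx dist01xx ltW.
  by exists y => k; apply: (yB k k) => /=.
have uniq x y : (forall k, dist01 (f k x) (g k y) <= s k) -> y = phi x.
  move=> xy; apply: sepg => k; have := xy k; have := phiP x k.
  have := dist01_triangle (f k x) (g k y) (g k (phi x)).
  rewrite (dist01C (g k y) (f k x)); lra.
exists phi; split=> // x.
have hL : hausdorff_space L.
  apply: (separated_hausdorff cg) => y y' yy'; apply: sepg => k.
  by rewrite yy' dist01xx mulr_ge0 // ltW.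
have clP y : cluster (phi @ x) y -> y = phi x.
  move=> cly; apply: uniq => k; rewrite leNgt; apply/negP => xy.
  pose W := [set z : K * L | dist01 (f k z.1) (g k z.2) <= s k].
  have [[A V] /= [nA nV] AV] : nbhs (x, y) (~` W).
    apply: open_nbhs_nbhs; split; last by apply/negP; rewrite -ltNge.
    apply: closed_openC; apply: closed_dist01_le => z.
      by apply: (continuous_comp _ (@cf _ _)); exact: cvg_fst.
    by apply: (continuous_comp _ (@cg _ _)); exact: cvg_snd.
  have [|_ [[z Az <-] Vz]] := cly (phi @` A) V _ nV.
    by apply: filterS nA => z Az; exists z.
  by apply: (AV (z, phi z)) => //; exact: phiP.
apply: (compact_cluster_set1 hL cL); [exact: filterT|exact: filterT|].
have [y [_ cly]] := cL (phi @ x) _ filterT.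
by apply/seteqP; split=> [z /clP //|_ ->]; rewrite -(clP _ cly).
Qed.

Lemma matched_homeomorphic (K L : topologicalType) (f : nat -> K -> I)
    (g : nat -> L -> I) (r : nat -> I -> I) (s : nat -> R) :
    compact [set: K] -> compact [set: L] ->
    (forall k, quotient_map (f k)) -> (forall k, quotient_map (g k)) ->
    (forall k, 0 < s k) ->
    coherent r s f -> coherent r s g ->
    (forall k a b, dist01 a b <= s k.+1 -> dist01 (r k a) (r k b) <= s k / 3) ->
    (forall x x', (forall k, dist01 (f k x) (f k x') <= 2 * s k) -> x = x') ->
    (forall y y', (forall k, dist01 (g k y) (g k y') <= 2 * s k) -> y = y') ->
  homeomorphic K L.
Proof.
move=> cK cL fq gq s0 rf rg rs sepf sepg.
have [phi [cphi phiP]] := matched_map cL fq gq s0 rf rg rs sepg.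
have [psi [cpsi psiP]] := matched_map cK gq fq s0 rg rf rs sepf.
exists phi, psi; split=> // [x|y].
  apply: sepf => k; have := phiP x k; have := psiP (phi x) k.
  have := dist01_triangle (g k (phi x)) (f k (psi (phi x))) (f k x).
  by rewrite (dist01C (f k _) (g k _)) (dist01C (g k _) (f k x)); lra.
apply: sepg => k; have := psiP y k; have := phiP (psi y) k.
have := dist01_triangle (f k (psi y)) (g k (phi (psi y))) (g k y).
by rewrite (dist01C (g k _) (f k _)) (dist01C (f k _) (g k y)); lra.
Qed.

End Matching.

(** * Back and forth *)

Section BackAndForth.
Variable R : realType.
Local Notation I := (unitI R).

Definition refinement (X Y : Type) (f : X -> I) (g : Y -> I) (s : R)
    (f' : X -> I) (g' : Y -> I) (s' : R) (r : I -> I) : Prop :=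
  [/\ forall x, dist01 (r (f' x)) (f x) <= s / 3,
      forall y, dist01 (r (g' y)) (g y) <= s / 3
    & forall a b, dist01 a b <= s' -> dist01 (r a) (r b) <= s / 3].

Definition separates_upto (X : Type) (q : nat -> X -> I) N (f : X -> I) (s : R) :=
  forall i x y, (i <= N)%N -> dist01 (f x) (f y) <= 2 * s ->
    dist01 (q i x) (q i y) <= N.+1%:R^-1.

(** The new f' is a late projection of K, which is how separation is achieved;
    condition (P) is used for the other space only. The new tolerance s' is
    chosen last, below the moduli of r and of the projections. *)
Lemma refine_step (K L : topologicalType) p (q : nat -> K -> I)
    (f : K -> I) (g : L -> I) (s : R) N :
    presentation p q -> condition_P R L ->
    quotient_map f -> quotient_map g -> 0 < s ->
  exists (f' : K -> I) (g' : L -> I) s' r, [/\ quotient_map f', quotient_map g', 0 < s',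
    refinement f g s f' g' s' r & separates_upto q N f' s'].
Proof.
move=> pK PL fq gq s0.
have s30 : 0 < s / 3 by rewrite divr_gt0.
have [n [r [d [rq rf d0 dq]]]] := presentation_factor N pK fq s30.
have [g' [g'q rg]] := PL _ _ _ s30 gq rq.
have [cr _] := rq.
have [d' d'0 rd'] := uniform_modulus cr s30.
have [_ _ qq _ _] := pK.
exists (q n), g', (Num.min d' (d / 2)), r; split=> //.
- by rewrite lt_min d'0 divr_gt0.
- split=> // [y|a b].
    by apply: ltW; apply: (rho_lt (@dist01_le1 R) rg).
  by rewrite le_min => /andP[ab _]; exact: rd'.
- move=> i x y iN xy; apply: dq => //; apply: le_trans xy _.
  have : Num.min d' (d / 2) <= d / 2 by rewrite ge_min lexx orbT.
  lra.
Qed.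

(** The steps alternate: odd ones refine through a projection of K, even ones
    through a projection of L. Separation at infinitely many stages suffices. *)
Lemma condition_P_homeomorphic (K L : topologicalType) pK pL
    (qK : nat -> K -> I) (qL : nat -> L -> I) :
  presentation pK qK -> presentation pL qL ->
  condition_P R K -> condition_P R L -> homeomorphic K L.
Proof.
move=> prK prL PK PL.
pose stage := ((K -> I) * (L -> I) * R)%type.
pose valid (x : stage) := [/\ quotient_map x.1.1, quotient_map x.1.2 & 0 < x.2].
pose next (kx : nat * stage) (yr : stage * (I -> I)) :=
  let: (k, x) := kx in let: (y, r) := yr in
  valid x -> [/\ valid y, refinement x.1.1 x.1.2 x.2 y.1.1 y.1.2 y.2 r
    & if odd k then separates_upto qK k y.1.1 y.2
      else separates_upto qL k y.1.2 y.2].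
have /choice[F FP] : forall kx, exists yr, next kx yr.
  move=> [k [[f g] s]] /=.
  have [[/= fq gq s0]|nv] := pselect (valid (f, g, s)); last first.
    (* An invalid stage is never reached; any answer will do. *)
    by exists ((f, g, s), id).
  case: (boolP (odd k)) => ok.
    have [f' [g' [s' [r [? ? ? ? ?]]]]] := refine_step k prK PL fq gq s0.
    by exists ((f', g', s'), r) => _.
  have [g' [f' [s' [r [? ? ? [? ? ?] ?]]]]] := refine_step k prL PK gq fq s0.
  by exists ((f', g', s'), r) => _.
pose X := fix X k := if k is k'.+1 then (F (k', X k')).1
  else (qK 0%N, qL 0%N, 1 : R).
pose r k := (F (k, X k)).2.
have nextX k : next (k, X k) (X k.+1, r k).
  by have := FP (k, X k); rewrite /r /=; case: (F _).
have validX k : valid (X k).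
  elim: k => [|k /nextX[]//].
  by split=> /=; [case: prK|case: prL|exact: ltr01].
have stepX k := nextX k (validX k).
have [cK _ _ _ sepK] := prK; have [cL _ _ _ sepL] := prL.
apply: (@matched_homeomorphic _ K L (fun k => (X k).1.1) (fun k => (X k).1.2) r
  (fun k => (X k).2)) => //.
- by move=> k; have [] := validX k.
- by move=> k; have [] := validX k.
- by move=> k; have [] := validX k.
- by move=> k x; have [_ []] := stepX k.
- by move=> k x; have [_ []] := stepX k.
- by move=> k; have [_ []] := stepX k.
- move=> x y xy; apply: sepK => i; apply: dist01_eq0.
  apply: (le_invS_eq0 (N := i)) => k ik.
  have [_ _] := stepX k.*2.+1; have -> : odd k.*2.+1 by rewrite /= odd_double.
  move=> sep.
  apply: le_trans (sep i x y _ (xy k.*2.+2)) (invS_le _ _).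
    by rewrite (leq_trans ik) // -addnn -addSn leq_addl.
  by rewrite -addnn -addSn leq_addl.
- move=> x y xy; apply: sepL => i; apply: dist01_eq0.
  apply: (le_invS_eq0 (N := i)) => k ik.
  have [_ _] := stepX k.*2; rewrite odd_double => sep.
  apply: le_trans (sep i x y _ (xy k.*2.+1)) (invS_le _ _).
    by rewrite (leq_trans ik) // -addnn leq_addl.
  by rewrite -addnn leq_addl.
Qed.

End BackAndForth.

Theorem theorem4p26 (R : realType) (u : nat -> Iobj)
    (p : nat -> nat -> unitI R -> unitI R) (K : topologicalType) :
  Fraisse_sequence u p -> chainable R K ->
  (homeomorphic K (@inverse_limit (fun=> unitI R) p) <-> condition_P R K).
Proof.
move=> Fp [[cK _ _] [pK [pKi pKq pKh]]].
have pa := Fraisse_absorbing Fp; have [pi pI _ _] := Fp.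
have pq n m : (n <= m)%N -> quotient_map (p n m) by case/pI.
split=> [KP|PK].
  have [q prK] := presentation_of_homeo pi pq cK KP.
  exact: absorbing_condition_P pi prK pa.
have [qK prK] := presentation_of_homeo pKi pKq cK pKh.
have cL := compact_inverse_limit (fun n m nm => (pq n m nm).1).
have [|qL prL] := presentation_of_homeo pi pq cL.
  by exists id, id; split=> // x.
by apply: (condition_P_homeomorphic prK prL PK); exact: absorbing_condition_P pi prL pa.
Qed.
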